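(* Let $|\cdot|$ be a pseudo-absolute value on a field $K$. Then $A_{|\cdot|}:=\{a\in K:|a|\neq+\infty\}$ is a valuation ring of $K$ with maximal ideal $\mathfrak m_{|\cdot|}:=\{a\in A_{|\cdot|}:|a|=0\}$. Further, $|\cdot|$ induces a multiplicative semi-norm on $A_{|\cdot|}$ with kernel $\mathfrak m_{|\cdot|}$.
   Context: A pseudo-absolute value on a field $K$ is a map $|\cdot| : K\to[0,+\infty]$ such that (i) $|1|=1$ and $|0|=0$; (ii) $|a+b|\le |a|+|b|$ for all $a,b\in K$; (iii) $|ab|=|a||b|$ for all $a,b\in K$ with $\{|a|,|b|\}\neq\{0,+\infty\}$. A valuation ring of $K$ is a subring $A\subset K$ such that for every $x\in K\setminus A$ one has $x^{-1}\in A$ (the case $A=K$ is allowed). *)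

(* Defs.v *)
From HB Require Import structures.
From mathcomp Require Import all_boot all_order all_algebra.
From mathcomp Require Import all_classical all_reals.

Set Implicit Arguments.
Unset Strict Implicit.
Unset Printing Implicit Defensive.

Import Order.TTheory GRing.Theory Num.Theory.
Local Open Scope classical_set_scope.
Local Open Scope ring_scope.

(* The codomain [0, +oo] is rendered by [\bar R] together with [pabs_ge0].
   [pabsM] compares unordered pairs of values as sets; it leaves the products
   0 * +oo and +oo * 0 unconstrained, whatever their value in [\bar R]. *)
Record pseudo_abs (R : realType) (K : fieldType) := PseudoAbs {
  pabs :> K -> \bar R;
  pabs_ge0 : forall a, (0 <= pabs a)%E;
  pabs1 : pabs 1 = 1%E;
  pabs0 : pabs 0 = 0%E;
  pabsD : forall a b, (pabs (a + b) <= pabs a + pabs b)%E;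
  pabsM : forall a b, [set pabs a; pabs b] <> [set 0%E; +oo%E] ->
    pabs (a * b) = (pabs a * pabs b)%E
}.

Record valuation_ring (K : fieldType) (A : {pred K}) : Prop := ValuationRing {
  valuation_ring_subring : subring_closed A;
  valuation_ring_inv : forall x, x \notin A -> x^-1 \in A
}.

(* The subset [A] as a ring in its own right, for the operations of [K]. *)
Definition valuation_ring_type (K : fieldType) (A : {pred K})
  (hA : valuation_ring A) : Type := {x : K | x \in A}.

Section ValuationRingType.
Variables (K : fieldType) (A : {pred K}) (hA : valuation_ring A).
Local Notation V := (valuation_ring_type hA).

HB.instance Definition _ := SubChoice.on V.
HB.instance Definition _ := GRing.SubChoice_isSubComNzRing.Build K A V
  (valuation_ring_subring hA).

End ValuationRingType.

(* [idealr_closed] already requires an ideal to be proper. *)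
Definition maximal_ideal (S : comNzRingType) (I : {pred S}) : Prop :=
  idealr_closed I /\
  forall J : {pred S}, idealr_closed J -> {subset I <= J} -> J =i I.

Definition unique_maximal_ideal (S : comNzRingType) (I : {pred S}) : Prop :=
  maximal_ideal I /\ forall J : {pred S}, maximal_ideal J -> J =i I.

(* The library's semi-normed Z-modules are not used, because they impose
   `|x *+ n| = `|x| *+ n, which fails for non-archimedean semi-norms. *)
Record multiplicative_seminorm (R : realType) (S : comNzRingType)
  (N : S -> R) : Prop := MultiplicativeSeminorm {
  mseminorm_ge0 : forall a, 0 <= N a;
  mseminorm0 : N 0 = 0;
  mseminormN : forall a, N (- a) = N a;
  mseminormD : forall a b, N (a + b) <= N a + N b;
  mseminorm1 : N 1 = 1;
  mseminormM : forall a b, N (a * b) = N a * N b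
}.

Section PseudoAbs.
Variables (R : realType) (K : fieldType) (v : pseudo_abs R K).

Definition pabs_ring : {pred K} := [pred a | v a != +oo%E].

Definition pabs_ideal (hA : valuation_ring pabs_ring) :
    {pred valuation_ring_type hA} :=
  [pred a | v (\val a) == 0%E].

End PseudoAbs.

Arguments pabs_ideal {R K v} hA.

(* Main.v *)
Require Import Defs.
From mathcomp Require Import all_boot all_order all_algebra.
From mathcomp Require Import all_classical all_reals.

(** Multiplicativity of a pseudo-absolute value [v] is only lost on a pair of
    values consisting of [0] and [+oo], so it holds between two elements of
    finite value and between two elements of nonzero value.

    The first case makes the elements of finite value a ring (the identity
    [(-1) * (-1) = 1] forces [v (-1) = 1], whence closure under subtraction),
    makes the elements of value [0] an ideal of it, and says that [v] is
    multiplicative there. The second case, applied to [x * x^-1 = 1], shows that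
    [x^-1] has finite value as soon as [v x] is nonzero
    ([pabs_inv_neq_pinfty]). This gives the valuation ring property for those
    [x] with [v x = +oo], and for those [x] with [v x] finite and nonzero it
    says that every element outside the ideal is a unit of the ring. A proper
    ideal contains no unit, so the elements of value [0] form the largest
    proper ideal, which is then the unique maximal one. *)

Set Implicit Arguments.
Unset Strict Implicit.
Unset Printing Implicit Defensive.

Import Order.TTheory GRing.Theory Num.Theory.
Local Open Scope ring_scope.

Lemma unique_maximal_ideal_largest (S : comNzRingType) (I : {pred S}) :
  idealr_closed I ->
  (forall J : {pred S}, idealr_closed J -> {subset J <= I}) ->
  unique_maximal_ideal I.
Proof.
move=> idI largestI; split.
  split=> // J idJ sIJ x.
  by apply/idP/idP => [/(largestI J idJ) | /sIJ].
move=> J [idJ maxJ] x.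
by rewrite (maxJ I idI (largestI J idJ)).
Qed.

Section PseudoAbsTheory.
Variables (R : realType) (K : fieldType) (v : pseudo_abs R K).

Lemma pabsM_neq_pinfty a b : v a != +oo%E -> v b != +oo%E ->
  v (a * b) = (v a * v b)%E.
Proof.
move=> /eqP va /eqP vb; apply: pabsM => /seteqP[_ /(_ +oo%E)].
by case=> [|/esym|/esym]; [right | exact: va | exact: vb].
Qed.

Lemma pabsM_neq0 a b : v a != 0%E -> v b != 0%E ->
  v (a * b) = (v a * v b)%E.
Proof.
move=> /eqP va /eqP vb; apply: pabsM => /seteqP[_ /(_ 0%E)].
by case=> [|/esym|/esym]; [left | exact: va | exact: vb].
Qed.

Lemma fineK_pabs a : v a != +oo%E -> (fine (v a))%:E = v a.
Proof. by move: (pabs_ge0 v a); case: (v a). Qed.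

Lemma pabsN1 : v (-1) = 1%E.
Proof.
have : v (-1 * -1)%R = (v (-1)%R * v (-1)%R)%E.
  (* a single value cannot be both 0 and +oo *)
  have [voo|vfin] := eqVneq (v (-1)) +oo%E; last exact: pabsM_neq_pinfty.
  by apply: pabsM_neq0; rewrite voo.
rewrite mulrNN mulr1 pabs1; move: (pabs_ge0 v (-1)).
case: (v (-1)) => [r|//|//]; rewrite lee_fin => r0 [] /esym/eqP.
by rewrite -expr2 sqrp_eq1// => /eqP ->.
Qed.

Lemma pabsN a : v (- a) = v a.
Proof.
rewrite -mulN1r; have [v0|n0] := eqVneq (v a) 0%E.
  by rewrite pabsM_neq_pinfty ?pabsN1 ?mul1e ?v0.
by rewrite pabsM_neq0 ?pabsN1 ?mul1e// eqe oner_eq0.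
Qed.

(** If [v x^-1] were infinite, so would be the value of [x * x^-1 = 1]. *)
Lemma pabs_inv_neq_pinfty x : v x != 0%E -> v x^-1 != +oo%E.
Proof.
move=> vx; apply/eqP => vVx.
have x0 : x != 0 by apply: contraNneq vx => ->; rewrite pabs0.
have vx_gt0 : (0 < v x)%E by rewrite lt_def vx pabs_ge0.
have := pabsM_neq0 vx; move=> /(_ x^-1).
by rewrite vVx divff// pabs1 gt0_muley// => /(_ isT).
Qed.

Lemma pabs_ring_valuation_ring : valuation_ring (pabs_ring v).
Proof.
split.
  split=> [|a b|a b]; rewrite !inE ?pabs1// => va vb.
    have := pabsD v a (- b); rewrite pabsN -(fineK_pabs va) -(fineK_pabs vb).
    by apply: contraTneq => ->.
  by rewrite pabsM_neq_pinfty// -(fineK_pabs va) -(fineK_pabs vb).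
move=> x; rewrite !inE negbK => /eqP vx.
by apply: pabs_inv_neq_pinfty; rewrite vx.
Qed.

Section ValuationRing.
Variable hA : valuation_ring (pabs_ring v).
Local Notation V := (valuation_ring_type hA).

Lemma val_pabs_neq_pinfty (a : V) : v (\val a) != +oo%E.
Proof. exact: (valP a). Qed.

Lemma pabs_valM (a b : V) : v (\val (a * b)) = (v (\val a) * v (\val b))%E.
Proof. by rewrite rmorphM pabsM_neq_pinfty ?val_pabs_neq_pinfty. Qed.

Lemma pabs_ideal_idealr_closed : idealr_closed (pabs_ideal hA).
Proof.
split=> [||a x y]; rewrite !inE.
- by rewrite rmorph0 pabs0.
- by rewrite rmorph1 pabs1 eqe oner_eq0.
move=> /eqP vx /eqP vy; rewrite eq_le pabs_ge0 andbT rmorphD.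
by rewrite (le_trans (pabsD v _ _))// pabs_valM vx vy mule0 adde0.
Qed.

(** An element of nonzero value is a unit of the ring, so an ideal containing it
    is not proper. *)
Lemma idealr_closed_sub_pabs_ideal (J : {pred V}) :
  idealr_closed J -> {subset J <= pabs_ideal hA}.
Proof.
case=> J0 J1 Jlin x Jx; rewrite inE; apply: contraNT J1 => vx.
have x0 : \val x != 0 by apply: contraNneq vx => ->; rewrite pabs0.
pose y : V := Sub (\val x)^-1 (pabs_inv_neq_pinfty vx).
suff -> : 1 = y * x + 0 :> V by exact: Jlin.
by rewrite addr0; apply: val_inj; rewrite rmorphM rmorph1; exact/esym/mulVf.
Qed.

Lemma pabs_multiplicative_seminorm :
  multiplicative_seminorm (fun a : V => fine (v (\val a))).
Proof.
split=> [a||a|a b||a b].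
- exact/fine_ge0/pabs_ge0.
- by rewrite rmorph0 pabs0.
- by rewrite rmorphN pabsN.
- by rewrite -lee_fin EFinD !fineK_pabs ?val_pabs_neq_pinfty// rmorphD pabsD.
- by rewrite rmorph1 pabs1.
apply: EFin_inj.
by rewrite EFinM !fineK_pabs ?val_pabs_neq_pinfty// pabs_valM.
Qed.

End ValuationRing.
End PseudoAbsTheory.

Theorem proposition2p1p2 (R : realType) (K : fieldType) (v : pseudo_abs R K) :
  exists hA : valuation_ring (pabs_ring v),
    unique_maximal_ideal (pabs_ideal hA) /\
    exists N : valuation_ring_type hA -> R,
      [/\ forall a, (N a)%:E = v (\val a),
          multiplicative_seminorm N
        & [pred a | N a == 0] =i pabs_ideal hA].
Proof.
exists (pabs_ring_valuation_ring v); split.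
  apply: unique_maximal_ideal_largest; first exact: pabs_ideal_idealr_closed.
  exact: idealr_closed_sub_pabs_ideal.
exists (fun a => fine (v (\val a))).
have fineKv a := fineK_pabs (@val_pabs_neq_pinfty _ _ v
  (pabs_ring_valuation_ring v) a).
split=> //; first exact: pabs_multiplicative_seminorm.
by move=> a; rewrite !inE -[in RHS]fineKv eqe.
Qed.
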